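(* Let $K$ be a field and $\ell$ a prime number different from the characteristic of $K$, and assume that either $\ell$ is odd, or $\ell = 2$ and $\zeta_4 \in K$. Let $a \in K^\times$ and let $m \geq n > 0$ be integers. 1. If $a = b^{\ell^d}$ for some $b \in K^\times$ strongly indivisible and some integer $d \geq 0$, then $$[K_{\ell^m}(\sqrt[\ell^n]{a}) : K_{\ell^m}] = \ell^{\max(0, n-d)}.$$ 2. Suppose $K = K_\ell \neq K_{\ell^\infty}$, and let $t \geq 1$ be the greatest integer such that $K_{\ell^t} = K$ (so $t\ge 2$ if $\ell=2$). Suppose moreover $m \geq t$. If $a = b^{\ell^d}\xi$ for some $b \in K^\times$ strongly indivisible, some integer $d > 0$ and some root of unity $\xi \in K$ of order $\ell^r$ with $r > \max(0, t-d)$, then $$[K_{\ell^m}(\sqrt[\ell^n]{a}) : K_{\ell^m}] = \ell^{\max(0, n-d, n+r-m)}.$$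
   Context: For $k\ge1$, $\zeta_{\ell^k}$ is a primitive $\ell^k$-th root of unity in a fixed algebraic closure, $K_{\ell^k} := K(\zeta_{\ell^k})$ and $K_{\ell^\infty} := \bigcup_{k \geq 1} K_{\ell^k}$. For $n\le m$ and $c\in K^\times$, $K_{\ell^m}(\sqrt[\ell^n]{c})$ denotes the field obtained by adjoining to $K_{\ell^m}$ an $\ell^n$-th root of $c$ (independent of the choice of root). An element $c \in K^\times$ is strongly indivisible (in $K$) if $c\xi$ has no $\ell$-th root in $K$ for every root of unity $\xi \in K$. *)

(* Defs.v *)
From HB Require Import structures.
From mathcomp Require Import all_boot all_order all_algebra.
From mathcomp Require Import boolp classical_sets.

Set Implicit Arguments.
Unset Strict Implicit.
Unset Printing Implicit Defensive.

Import GRing.Theory.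
Local Open Scope classical_set_scope.
Local Open Scope ring_scope.

Section Subfields.
Variable L : fieldType.
Implicit Types (E F : set L) (x : L) (d : nat).

(* As 0^-1 = 0 in a fieldType, closure under inverses needs no [x != 0]. *)
Definition is_subfield E : Prop :=
  [/\ E 1,
      (forall x y, E x -> E y -> E (x - y)),
      (forall x y, E x -> E y -> E (x * y)) &
      (forall x, E x -> E x^-1)].

Definition adjoin F x : set L := smallest is_subfield (F `|` [set x]).

Definition is_basis F E d (e : 'I_d -> L) : Prop :=
  [/\ (forall i, E (e i)),
      (forall c : 'I_d -> L, (forall i, F (c i)) ->
         \sum_(i < d) c i * e i = 0 -> forall i, c i = 0) &
      (forall x, E x -> exists2 c : 'I_d -> L,
         (forall i, F (c i)) & x = \sum_(i < d) c i * e i)].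

(* [E : F] = d, for subfields F `<=` E of L; a relation because [E : F] may be
   infinite. *)
Definition has_degree F E d : Prop := exists e : 'I_d -> L, is_basis F E e.

End Subfields.

Section Closure.
Variables (K : fieldType) (Kbar : closedFieldType) (iota : {rmorphism K -> Kbar}).

Definition is_algebraic_closure : Prop := forall x : Kbar, algebraicOver iota x.

(* In the next two definitions, zeta k plays the role of a primitive l^k-th
   root of unity, so that cyclo zeta k is K_{l^k}. *)
Definition cyclo (zeta : nat -> Kbar) (k : nat) : set Kbar :=
  adjoin (range iota) (zeta k).

Definition cyclo_infty (zeta : nat -> Kbar) : set Kbar :=
  \bigcup_(k in [set k | (1 <= k)%N]) cyclo zeta k.

End Closure.

Definition is_root_of_unity (K : fieldType) (xi : K) : Prop :=
  exists2 k : nat, (0 < k)%N & xi ^+ k = 1.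

Definition strongly_indivisible (K : fieldType) (l : nat) (c : K) : Prop :=
  forall xi : K, is_root_of_unity xi -> ~ exists y : K, y ^+ l = c * xi.

(* Main.v *)
Require Import Defs.
From HB Require Import structures.
From mathcomp Require Import all_boot all_order all_algebra.
From mathcomp Require Import boolp classical_sets.
From mathcomp Require Import zify.

Set Implicit Arguments.
Unset Strict Implicit.
Unset Printing Implicit Defensive.

Import GRing.Theory.
Local Open Scope classical_set_scope.
Local Open Scope ring_scope.

(* Since [K_(l^m)] contains the [l^m]-th roots of unity, Kummer theory reduces the
   degree to the question of which [l]-powers [a] is in [K_(l^m)]. The key invariant
   for a field [F] containing [z = zeta_(l^k)] is that [b^i z^j] is an [l]-th power
   in [F] only if [l] divides both [i] and [j]. It holds for [F = K_l] and the last
   [z] lying in [K_l], because strong indivisibility of [b] passes from [K] to [K_l],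
   whose degree over [K] is prime to [l]. It climbs one step [F(h)], [h^l = z], as
   follows: the norm of [b^i h^j] is [b^(il) (+-z)^j], so that [l] divides [j]; then
   [b^i z^(j/l)] lies in [F], and its [l]-th root in [F(h)] has the form [q h^k] with
   [q] in [F], so that [l] divides [i]. The condition on [zeta_4] makes the sign an
   [l]-th power. *)

(** * Subfields as field types *)

Section SubfieldType.
Variables (L : fieldType) (E : set L) (E_subfield : is_subfield E).

(* Mentioning [E_subfield] lets the closure instance below be inferred. *)
Definition subfield_pred : {pred L} := let _ := E_subfield in fun x => `[< E x >].

Fact subfield_pred_divring_closed : divring_closed subfield_pred.
Proof.
have [E1 EB EM EV] := E_subfield.
split=> [|x y /asboolP Ex /asboolP Ey|x y /asboolP Ex /asboolP Ey].
- exact/asboolP.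
- exact/asboolP/EB.
- by apply/asboolP/EM => //; apply: EV.
Qed.

HB.instance Definition _ :=
  GRing.isDivringClosed.Build L subfield_pred subfield_pred_divring_closed.

Record subfield_type :=
  SubfieldType { subfield_val :> L; _ : subfield_val \in subfield_pred }.

HB.instance Definition _ := [isSub for subfield_val].
HB.instance Definition _ := [Choice of subfield_type by <:].
HB.instance Definition _ := [SubChoice_isSubIntegralDomain of subfield_type by <:].
HB.instance Definition _ := [SubIntegralDomain_isSubField of subfield_type by <:].

End SubfieldType.

(** Polynomials and matrices need a coefficient type, so a subfield given as a set is traded for the
    image of a field morphism. *)
Lemma subfield_as_range (L : fieldType) (E : set L) :
  is_subfield E -> exists (F : fieldType) (f : {rmorphism F -> L}), range f = E.
Proof.
move=> E_subfield; exists (subfield_type E_subfield).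
exists (val : {rmorphism subfield_type E_subfield -> L}).
rewrite eqEsubset; split=> [_ [[x /= /asboolP Ex] _ <-] //|x Ex].
have xE : x \in subfield_pred E_subfield by apply/asboolP.
by exists (SubfieldType xE).
Qed.

Lemma range_subfield (F L : fieldType) (f : {rmorphism F -> L}) :
  is_subfield (range f).
Proof.
split=> [|_ _ [x _ <-] [y _ <-]|_ _ [x _ <-] [y _ <-]|_ [x _ <-]].
- by exists 1; rewrite ?rmorph1.
- by exists (x - y); rewrite ?rmorphB.
- by exists (x * y); rewrite ?rmorphM.
- by exists x^-1; rewrite ?fmorphV.
Qed.

Section SubfieldTheory.
Variables (L : fieldType) (E : set L).
Hypothesis E_subfield : is_subfield E.

Lemma subfield1 : E 1. Proof. by case: E_subfield. Qed.
Lemma subfieldM x y : E x -> E y -> E (x * y).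
Proof. by case: E_subfield => _ _ + _; apply. Qed.
Lemma subfieldV x : E x -> E x^-1. Proof. by case: E_subfield => _ _ _; apply. Qed.
Lemma subfieldX x n : E x -> E (x ^+ n).
Proof.
move=> Ex; elim: n => [|n IHn]; first exact: subfield1.
by rewrite exprS; apply: subfieldM.
Qed.

End SubfieldTheory.

(** * Adjunction of one element *)

Section Adjoin.
Variable L : fieldType.
Implicit Types (E F : set L) (x y : L).

Lemma adjoin_subfield F x : is_subfield (adjoin F x).
Proof.
split=> [E [[]] //|y z yF zF|y z yF zF|y yF] E FE.
- by have [[_ + _ _] _] := FE; apply; [apply: yF | apply: zF].
- by have [[_ _ + _] _] := FE; apply; [apply: yF | apply: zF].
- by have [[_ _ _ +] _] := FE; apply; apply: yF.
Qed.

Lemma adjoin_base F x : F `<=` adjoin F x.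
Proof. by move=> y Fy E [_]; apply; left. Qed.

Lemma adjoin_gen F x : adjoin F x x.
Proof. by move=> E [_]; apply; right. Qed.

Lemma adjoinX F x n : adjoin F x (x ^+ n).
Proof. exact: (subfieldX (adjoin_subfield F x) n (@adjoin_gen F x)). Qed.

Lemma adjoin_sub F E x : is_subfield E -> F `<=` E -> E x -> adjoin F x `<=` E.
Proof.
by move=> E_subfield FE Ex; apply: smallest_sub => // y [/FE //|->].
Qed.

Lemma adjoin_id E x : is_subfield E -> E x -> adjoin E x = E.
Proof.
move=> E_subfield Ex; rewrite eqEsubset; split; last exact: adjoin_base.
exact: adjoin_sub.
Qed.

Lemma eq_adjoin F x y :
  adjoin F y x -> adjoin F x y -> adjoin F x = adjoin F y.
Proof.
move=> xy yx; rewrite eqEsubset; split;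
by apply: adjoin_sub => //; [apply: adjoin_subfield | apply: adjoin_base].
Qed.

Lemma adjoin_adjoin F x y : adjoin F y x -> adjoin (adjoin F x) y = adjoin F y.
Proof.
move=> xy; rewrite eqEsubset; split; apply: adjoin_sub.
- exact: adjoin_subfield.
- by apply: adjoin_sub => //; [apply: adjoin_subfield | apply: adjoin_base].
- exact: adjoin_gen.
- exact: adjoin_subfield.
- by apply: subset_trans (@adjoin_base _ _); apply: adjoin_base.
- exact: adjoin_gen.
Qed.

End Adjoin.

(** * Simple algebraic extensions: degrees of radicals, norms, minimal polynomials *)

(** As [x] is algebraic, the polynomial values at [x] are already closed under inverses, hence form
    the whole field. *)
Lemma adjoinP (F L : fieldType) (f : {rmorphism F -> L}) (x : L) (P : {poly F}) :
  P != 0 -> root (map_poly f P) x ->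
  forall y, adjoin (range f) x y <-> exists q, y = (map_poly f q).[x].
Proof.
move=> P0 Px y; split=> [|[q ->]]; last first.
  have xE := @adjoin_gen L (range f) x.
  have [E1 EB EM _] := adjoin_subfield (range f) x.
  have E0 : adjoin (range f) x 0 by rewrite -(subrr 1); apply: EB.
  elim/poly_ind: q => [|q c IHq]; first by rewrite rmorph0 horner0.
  rewrite rmorphD rmorphM /= map_polyX map_polyC !hornerE -[X in _ + X]opprK.
  apply: (EB); first exact: EM.
  by rewrite -sub0r; apply: EB => //; apply: adjoin_base; exists c.
move: y; apply: (@adjoin_sub _ _ [set y | exists q, y = (map_poly f q).[x]]).
2: by move=> _ [c _ <-]; exists c%:P; rewrite map_polyC hornerC.
2: by exists 'X; rewrite map_polyX hornerX.
split=> [|_ _ [q ->] [r ->]|_ _ [q ->] [r ->]|_ [q ->]].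
- by exists 1; rewrite rmorph1 hornerC.
- by exists (q - r); rewrite rmorphB !hornerE.
- by exists (q * r); rewrite rmorphM !hornerE.
have [->|qx0] := eqVneq (map_poly f q).[x] 0.
  by exists 0; rewrite invr0 rmorph0 horner0.
(* [gdcop q P] is the part of [P] coprime to [q]. It keeps the root [x], which is not a root of [q],
   so a Bezout relation with [q], evaluated at [x], gives the inverse. *)
have Q_root : root (map_poly f (gdcop q P)) x.
  by rewrite gdcop_map root_gdco ?map_poly_eq0 // Px.
have /Bezout_eq1_coprimepP[[u v] /= uv1] := coprimep_gdco q P0.
exists v; apply: (mulIf qx0); rewrite mulVf //.
have := congr1 (fun r => (map_poly f r).[x]) uv1.
by rewrite rmorphD !rmorphM rmorph1 !hornerE (rootP Q_root) mulr0 add0r => ->.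
Qed.

(** The powers [x ^+ i] with [i < N] form a basis: they span by reduction modulo ['X^N - c%:P], and
    the last hypothesis is their freeness. *)
Lemma has_degree_adjoin (F L : fieldType) (f : {rmorphism F -> L}) (x : L)
    (N : nat) (c : F) :
  (0 < N)%N -> x ^+ N = f c ->
  (forall q : {poly F}, root (map_poly f q) x -> (size q <= N)%N -> q = 0) ->
  has_degree (range f) (adjoin (range f) x) N.
Proof.
move=> N_gt0 xN q0; set P := 'X^N - c%:P.
have sizeP : size P = N.+1 by rewrite size_XnsubC.
have P0 : P != 0 by rewrite -size_poly_eq0 sizeP.
have Px : (map_poly f P).[x] = 0.
  by rewrite rmorphB /= map_polyXn map_polyC !hornerE xN subrr.
have sum_horner (q : {poly F}) : (size q <= N)%N ->
    (map_poly f q).[x] = \sum_(i < N) f q`_i * x ^+ i.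
  move=> sq; rewrite (@horner_coef_wide _ N) ?size_map_poly //.
  by apply: eq_bigr => i _; rewrite coef_map.
exists (fun i : 'I_N => x ^+ i); split=> [i|a aF|y].
- exact: adjoinX.
- have /choice[a' fa'] i : exists a', f a' = a i by have [a' _] := aF i; exists a'.
  (* [insub] turns the index into an element of ['I_N]; the default [0] is never reached below
     [N]. *)
  move=> sum0 i; pose q := \poly_(i < N) if insub i is Some j then a' j else 0.
  have qE (j : 'I_N) : q`_j = a' j by rewrite coef_poly ltn_ord valK.
  suff q_eq0 : q = 0 by rewrite -fa' -qE q_eq0 coef0 rmorph0.
  apply: q0; last exact: size_poly.
  rewrite rootE sum_horner ?size_poly // -[X in _ == X]sum0; apply/eqP.
  by apply: eq_bigr => j _; rewrite qE fa'.
- case/(adjoinP P0 (introT rootP Px)) => q ->.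
  exists (fun i : 'I_N => f (q %% P)`_i) => [i|]; first by exists (q %% P)`_i.
  rewrite -sum_horner; last by rewrite -ltnS -sizeP ltn_modp.
  by rewrite {1}(divp_eq q P) rmorphD rmorphM /= !hornerE Px mulr0 add0r.
Qed.

(** This is the irreducibility of ['X^(l ^ e) - c%:P], whose roots are the [w ^+ i * g]. A proper
    factor would put some [g ^+ (l ^ h)] with [h < e] in [F], and with it an [l]-th root of [c]. *)
Lemma kummer_root_size (F L : fieldType) (f : {rmorphism F -> L}) (l e : nat)
    (w c : F) (g : L) :
  prime l -> (l ^ e)%N.-primitive_root w -> c != 0 -> g ^+ (l ^ e) = f c ->
  ((0 < e)%N -> forall x, x ^+ l <> c) ->
  forall q, root (map_poly f q) g -> (size q <= l ^ e)%N -> q = 0.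
Proof.
move=> l_prime w_prim c0 gN c_nopow q qg size_q; apply/eqP.
have [//|q0] := eqVneq q 0; exfalso.
set N := (l ^ e)%N in w_prim gN size_q.
have N_gt0 : (0 < N)%N by rewrite expn_gt0 prime_gt0.
have g0 : g != 0.
  apply: contra_neq c0 => g0; apply: (fmorph_inj f).
  by rewrite -gN g0 expr0n eqn0Ngt N_gt0 (rmorph0 f).
pose P : {poly F} := 'X^N - c%:P; pose p := gcdp q P.
have map_PE : map_poly f P = 'X^N - (f c)%:P.
  by rewrite rmorphB /= map_polyXn map_polyC.
have p0 : p != 0 by rewrite gcdp_eq0 negb_and q0.
have pg : root (map_poly f p) g.
  by rewrite gcdp_map root_gcd qg map_PE rootE !hornerE gN subrr eqxx.
have p_size : (size p <= N)%N by apply: leq_trans size_q; rewrite dvdp_leq ?dvdp_gcdl.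
have fw_prim : N.-primitive_root (f w) by rewrite fmorph_primitive_root.
have PE : map_poly f P = \prod_(i <- index_iota 0 N) ('X - (f w ^+ i * g)%:P).
  pose rs := [seq f w ^+ i * g | i <- index_iota 0 N].
  rewrite map_PE (@all_roots_prod_XsubC _ ('X^N - (f c)%:P) rs).
  - by rewrite lead_coefXnsubC // scale1r big_map.
  - by rewrite size_XnsubC // size_map size_iota subn0.
  - apply/allP => _ /mapP[i _ ->]; rewrite rootE !hornerE exprMn gN -exprM mulnC.
    by rewrite exprM (prim_expr_order fw_prim) expr1n mul1r subrr.
  - rewrite uniq_rootsE map_inj_in_uniq ?iota_uniq // => i j.
    rewrite !mem_index_iota /= => iN jN /(mulIf g0)/eqP.
    by rewrite (eq_prim_root_expr fw_prim) !modn_small // => /eqP.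
have [s ps] : {s : seq nat |
    map_poly f p %= \prod_(i <- s) ('X - (f w ^+ i * g)%:P)}.
  have : map_poly f p %| map_poly f P by rewrite dvdp_map dvdp_gcdr.
  by rewrite PE => /dvdp_prod_XsubC[k pk]; exists (mask k (index_iota 0 N)).
have s_size : size p = (size s).+1.
  by rewrite -(size_map_poly f) (eqp_size ps) size_prod_XsubC.
have s_gt0 : (0 < size s)%N.
  by have := root_size_gt1 _ pg; rewrite size_map_poly s_size map_poly_eq0; apply.
(* The constant coefficient of [p] puts a power of [g] of exponent
   [deg p < l ^ e] in [F]. *)
have [u gs] : exists u, g ^+ size s = f u.
  have := eqp_eq ps; rewrite (monicP (monic_prod_XsubC _ _ _)) scale1r.
  move=> /(congr1 (fun r => r.[0])); rewrite hornerZ lead_coef_map horner_prod.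
  have -> : (map_poly f p).[0] = f p.[0] by rewrite -(rmorph0 f) horner_map.
  under eq_bigr do rewrite !hornerE -mulNr -rmorphXn -rmorphN.
  rewrite big_split /= -rmorph_prod big_const_seq count_predT iter_mulr_1.
  rewrite mulrA -rmorphM => pE.
  set v := _ * \prod_(_ <- _) _ in pE; exists (p.[0] / v).
  have v0 : v != 0.
    rewrite mulf_neq0 ?lead_coef_eq0 // prodf_seq_neq0; apply/allP => i _ /=.
    by rewrite oppr_eq0 expf_neq0 // (prim_root_eq0 w_prim) -lt0n.
  by rewrite fmorph_div pE mulrC mulKf // fmorph_eq0.
(* The powers of [g] of exponents [size s] and [N] lie in [F]; by Bezout so does the one whose
   exponent is their gcd, a power of [l] smaller than [N]. *)
have [y gy] : exists y, g ^+ gcdn (size s) N = f y.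
  have [a b ab _] := egcdnP N s_gt0; exists (u ^+ a / c ^+ b).
  rewrite fmorph_div !rmorphXn -gs -gN -!exprM [(size s * a)%N]mulnC ab exprD.
  by rewrite [(N * b)%N]mulnC mulrAC divff ?mul1r // expf_neq0.
have /(dvdn_pfactor _ _ l_prime)[h he gcdE] := dvdn_gcdr (size s) N.
have lt_he : (h < e)%N.
  rewrite -(ltn_exp2l _ _ (prime_gt1 l_prime)) -gcdE.
  apply: leq_ltn_trans (dvdn_leq s_gt0 (dvdn_gcdl _ _)) _.
  by rewrite -s_size.
apply: (c_nopow (leq_ltn_trans (leq0n h) lt_he) (y ^+ (l ^ (e - h.+1)))).
apply: (fmorph_inj f); rewrite -exprM -expnSr -subSn // subSS.
by rewrite rmorphXn -gy gcdE -exprM -expnD subnKC.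
Qed.

(* The relative norm of [F[X] / (p)], as the determinant of the multiplication
   by a polynomial. *)
Lemma poly_norm (F : fieldType) (p : {poly F}) :
  p \is monic -> (1 < size p)%N ->
  exists N : {poly F} -> F,
    [/\ {morph N : q r / q * r}, (forall c, N c%:P = c ^+ (size p).-1),
        N 'X = (-1) ^+ (size p).-1 * p`_0 &
        (forall q r, p %| q - r -> N q = N r)].
Proof.
move=> p_monic p_size.
(* Hiding the companion matrix behind an existential lets the case analysis on [size p] give it a
   dimension of the form [n.+1]. *)
have := ex_intro (fun A => char_poly A = p) _ (companionmxK p_monic).
case: (size p) p_size => [|[|n]] //= _ [A charA].
exists (fun q => \det (horner_mx A q)); split=> [q r|c||q r].
- by rewrite rmorphM /= -det_mulmx.
- by rewrite horner_mx_C det_scalar.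
- by rewrite horner_mx_X -charA char_poly_det mulrA -exprMn mulrNN mulr1 expr1n mul1r.
- case/dvdpP=> s qrE; congr (\det _); apply/eqP; rewrite -subr_eq0 -rmorphB qrE.
  by rewrite rmorphM /= -charA Cayley_Hamilton mulr0.
Qed.

Lemma poly_normX (F : fieldType) (p : {poly F}) (N : {poly F} -> F) :
  {morph N : q r / q * r} -> (forall c, N c%:P = c ^+ (size p).-1) ->
  forall q n, N (q ^+ n) = N q ^+ n.
Proof.
move=> NM NC q; elim=> [|n IHn]; last by rewrite !exprS NM IHn.
by rewrite !expr0 -polyC1 NC expr1n.
Qed.

Lemma min_poly_exists (F L : fieldType) (f : {rmorphism F -> L}) (x : L)
    (P : {poly F}) :
  P != 0 -> root (map_poly f P) x ->
  exists p, [/\ p \is monic, root (map_poly f p) x &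
                forall q, root (map_poly f q) x -> p %| q].
Proof.
move=> P0 Px.
pose annihilated n := `[< exists q : {poly F},
  [/\ q != 0, root (map_poly f q) x & size q = n] >].
have : exists n, annihilated n by exists (size P); apply/asboolP; exists P.
case/ex_minnP=> _ /asboolP[p [p0 px <-]] p_min; exists ((lead_coef p)^-1 *: p).
have lc0 : (lead_coef p)^-1 != 0 by rewrite invr_eq0 lead_coef_eq0.
split=> [||q qx].
- by rewrite monicE lead_coefZ mulVf // lead_coef_eq0.
- by rewrite map_polyZ rootE hornerZ (rootP px) mulr0.
- rewrite dvdpZl //; apply: contraT; rewrite /dvdp -/(modp _ _) => r0.
  have := ltn_modp q p; rewrite p0 ltnNge p_min //; apply/asboolP.
  exists (q %% p); split=> //; have := qx; rewrite {1}(divp_eq q p).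
  by rewrite !rootE rmorphD rmorphM /= !hornerE (rootP px) mulr0 add0r.
Qed.

Lemma root_of_unityX (F : fieldType) (x : F) n :
  is_root_of_unity x -> is_root_of_unity (x ^+ n).
Proof. by case=> k k_gt0 xk; exists k; rewrite // exprAC xk expr1n. Qed.

(** The witness is [1 + 'X + ... + 'X^(l - 1)]. Its degree is less than [l], so the degree of [z]
    over [F] is prime to [l]. *)
Lemma prim_root_size (F L : fieldType) (f : {rmorphism F -> L}) (l : nat) (z : L) :
  prime l -> l.-primitive_root z ->
  exists p : {poly F}, [/\ p != 0, root (map_poly f p) z & (size p <= l)%N].
Proof.
move=> l_prime z_prim; exists (\poly_(i < l) 1); split; last exact: size_poly.
  apply/eqP => /(congr1 (fun p : {poly F} => p`_0)).
  by rewrite coef_poly coef0 prime_gt0 //; apply/eqP/oner_neq0.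
rewrite rootE (@horner_coef_wide _ l) ?size_map_poly ?size_poly //.
under eq_bigr do rewrite coef_map coef_poly ltn_ord /= rmorph1 mul1r.
have : (z - 1) * \sum_(i < l) z ^+ i == 0.
  by rewrite -subrX1 (prim_expr_order z_prim) subrr.
rewrite mulf_eq0 subr_eq0 => /orP[/eqP z1|//].
have := prim_order_dvd z_prim 1; rewrite z1 expr1n eqxx dvdn1.
by case: eqP l_prime => // ->.
Qed.

(* The degree of [F1] over [F] is prime to [l], so that taking norms loses nothing
   modulo [l]-th powers. *)
Lemma strongly_indivisible_adjoin (F F1 L : fieldType) (f : {rmorphism F -> L})
    (f1 : {rmorphism F1 -> L}) (l : nat) (z : L) (b : F) (b1 : F1) :
  prime l -> l.-primitive_root z -> range f1 = adjoin (range f) z ->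
  f1 b1 = f b -> b != 0 -> strongly_indivisible l b -> strongly_indivisible l b1.
Proof.
move=> l_prime z_prim f1E b1E b0 b_sind xi [k k_gt0 xik] [x xl].
have [P [P0 Pz P_size]] := prim_root_size f l_prime z_prim.
have [p [p_monic pz p_min]] := min_poly_exists P0 Pz.
have p_size : (1 < size p <= l)%N.
  rewrite (leq_trans (dvdp_leq P0 (p_min _ Pz)) P_size) andbT.
  by have := root_size_gt1 _ pz; rewrite map_poly_eq0 size_map_poly monic_neq0 //; apply.
have [D_gt0 D_lt] : (0 < (size p).-1)%N /\ ((size p).-1 < l)%N.
  by case: (size p) p_size => [|[]].
have [N [NM NC _ Np]] := poly_norm p_monic (proj1 (andP p_size)).
have f1P y : exists q, f1 y = (map_poly f q).[z].
  by apply/(adjoinP P0 Pz); rewrite -f1E; exists y.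
have [r rE] := f1P x; have [q qE] := f1P xi.
(* The norm sends the root of unity [xi], represented by [q], to a root of unity of [F]. *)
have Nq : N q ^+ k = 1.
  rewrite -(poly_normX NM NC) -(expr1n _ (size p).-1) -NC; apply/Np/p_min.
  rewrite rootE rmorphB rmorphXn /= map_polyC !hornerE -qE -rmorphXn xik.
  by rewrite /= !rmorph1 subrr.
have Nr : N r ^+ l = b ^+ (size p).-1 * N q.
  rewrite -(poly_normX NM NC) -NC -NM; apply/Np/p_min.
  rewrite rootE rmorphB rmorphM rmorphXn /= map_polyC !hornerE -qE -rE /= -b1E.
  by rewrite -rmorphM -rmorphXn xl subrr.
(* The relation [u * (size p).-1 = v * l + 1] recovers [b] itself, up to an [l]-th power and a root
   of unity, from the power of [b] given by the norm. *)
have [u v uv _] := egcdnP l D_gt0.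
have D_coprime : coprime (size p).-1 l.
  by rewrite coprime_sym prime_coprime // gtnNdvd.
rewrite (eqP D_coprime) in uv.
apply: (b_sind (N q ^+ u)); first by apply: root_of_unityX; exists k.
exists (N r ^+ u / b ^+ v); rewrite exprMn exprVn -!exprM [(u * l)%N]mulnC.
rewrite exprM Nr exprMn -exprM [(_ * u)%N]mulnC uv exprD expr1 mulrAC.
by congr (_ * _); rewrite mulrAC divff ?mul1r // expf_neq0.
Qed.

(** * Independence modulo [l]-th powers and its ascent along a tower *)

(** For nonzero [b] and [z] in [E] and [l] prime, this is the linear independence over the field
    with [l] elements of their classes modulo [l]-th powers of [E]. *)
Definition independent_mod (L : fieldType) (l : nat) (E : set L) (b z : L) : Prop :=
  forall i j x, E x -> x ^+ l = b ^+ i * z ^+ j -> (l %| i)%N /\ (l %| j)%N.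

(** A smaller order of [w] would divide [l ^ t], and that of [z] would then divide [l ^ t.-1].
    Positivity of [t] matters: [1] is an [l]-th root of [1]. *)
Lemma prim_root_lroot (F : fieldType) (l t : nat) (z w : F) :
  prime l -> (0 < t)%N -> (l ^ t)%N.-primitive_root z -> w ^+ l = z ->
  (l ^ t.+1)%N.-primitive_root w.
Proof.
move=> l_prime t_gt0 z_prim wl.
have lt1_gt0 : (0 < l ^ t.+1)%N by rewrite expn_gt0 prime_gt0.
have w1 : w ^+ (l ^ t.+1) = 1 by rewrite expnS exprM wl (prim_expr_order z_prim).
have [o + /(dvdn_pfactor _ _ l_prime)[h ht oE]] := prim_order_exists lt1_gt0 w1.
rewrite {o}oE; move: ht; rewrite leq_eqVlt => /predU1P[-> //|ht w_prim]; exfalso.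
have : z ^+ (l ^ t.-1) == 1.
  by rewrite -wl -exprM -expnS prednK // -(prim_order_dvd w_prim) dvdn_exp2l.
rewrite -(prim_order_dvd z_prim) dvdn_Pexp2l ?prime_gt1 //.
by rewrite -ltnS prednK // ltnn.
Qed.

(** Otherwise a Bezout relation [u * i = v * l + 1] would make [b * xi ^+ u] an [l]-th power. *)
Lemma strongly_indivisible_coprime (F : fieldType) (l : nat) (b xi x : F) (i : nat) :
  prime l -> b != 0 -> strongly_indivisible l b -> is_root_of_unity xi ->
  x ^+ l = b ^+ i * xi -> (l %| i)%N.
Proof.
move=> l_prime b0 b_sind xi_unity xl; apply: contraT; rewrite -prime_coprime //.
rewrite coprime_sym => il; have i_gt0 : (0 < i)%N.
  by case: i il {xl} => //; rewrite /coprime gcd0n; case: eqP l_prime => // ->.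
have [u v + _] := egcdnP l i_gt0; rewrite (eqP il) => uv.
case: (b_sind (xi ^+ u)); first exact: root_of_unityX.
exists (x ^+ u / b ^+ v); rewrite exprMn exprVn -!exprM [(u * l)%N]mulnC.
rewrite exprM xl exprMn -exprM [(i * u)%N]mulnC uv exprD expr1 mulrAC.
by congr (_ * _); rewrite mulrAC divff ?mul1r // expf_neq0.
Qed.

(** Strong indivisibility handles [i]. After division by an [l]-th power of a power of [b], an
    exponent [j] prime to [l] would produce a primitive [l ^ t.+1]-th root of unity in [F]. *)
Lemma independent_base (F L : fieldType) (f : {rmorphism F -> L}) (l t : nat)
    (b z : F) :
  prime l -> (0 < t)%N -> (l ^ t)%N.-primitive_root z ->
  (forall w : F, ~ (l ^ t.+1)%N.-primitive_root w) ->
  b != 0 -> strongly_indivisible l b ->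
  independent_mod l (range f) (f b) (f z).
Proof.
move=> l_prime t_gt0 z_prim no_prim b0 b_sind i j _ [x _ <-].
rewrite -!rmorphXn -rmorphM => /fmorph_inj xl.
have z_unity : is_root_of_unity (z ^+ j).
  by apply: root_of_unityX; exists (l ^ t)%N; rewrite ?expn_gt0 ?prime_gt0 ?prim_expr_order.
have li := strongly_indivisible_coprime l_prime b0 b_sind z_unity xl.
split=> //; apply: contraT; rewrite -prime_coprime // => lj; exfalso.
apply: (no_prim (x / b ^+ (i %/ l))); apply: prim_root_lroot (z ^+ j) _ _ _ _ _ => //.
  by rewrite prim_root_exp_coprime // coprime_sym coprimeXl.
rewrite exprMn exprVn -exprM divnK // xl mulrAC divff ?mul1r //.
by rewrite expf_neq0.
Qed.

Lemma independent_step (F L : fieldType) (f : {rmorphism F -> L}) (l : nat)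
    (w s b z : F) (h : L) :
  prime l -> l.-primitive_root w -> (-1) ^+ l.+1 = s ^+ l -> b != 0 -> z != 0 ->
  h ^+ l = f z -> independent_mod l (range f) (f b) (f z) ->
  independent_mod l (adjoin (range f) h) (f b) h.
Proof.
move=> l_prime w_prim sl b0 z0 hl indep i j y.
have indepF i' j' x : x ^+ l = b ^+ i' * z ^+ j' -> (l %| i')%N /\ (l %| j')%N.
  by move=> xl; apply: (indep i' j' (f x)); [exists x | rewrite -!rmorphXn -rmorphM xl].
have l_gt0 := prime_gt0 l_prime.
have h0 : h != 0.
  apply: contra_neq z0 => h0; apply: (fmorph_inj f).
  by rewrite -hl h0 (rmorph0 f) expr0n eqn0Ngt l_gt0.
(* Independence with [i = 0] and [j = 1] says that [z] is not an [l]-th power, so [h] has degree [l]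
   over [F]. *)
have ker0 q : root (map_poly f q) h -> (size q <= l)%N -> q = 0.
  move=> qh q_size; apply: (@kummer_root_size F L f l 1 w z h); rewrite ?expn1 //.
  move=> _ x xl; have [_] : (l %| 0)%N /\ (l %| 1)%N.
    by apply: (indepF _ _ x); rewrite xl expr0 mul1r.
  by rewrite dvdn1 => /eqP l1; rewrite l1 in l_prime.
pose P : {poly F} := 'X^l - z%:P.
have P_monic : P \is monic by rewrite monicXnsubC.
have P_size : size P = l.+1 by rewrite size_XnsubC.
have P0 : P != 0 by rewrite monic_neq0.
have Pf x : (map_poly f P).[x] = x ^+ l - f z.
  by rewrite rmorphB /= map_polyXn map_polyC !hornerE.
have Ph : root (map_poly f P) h by rewrite rootE Pf hl subrr.
have horner_mod q x : x ^+ l = f z ->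
    (map_poly f (q %% P)).[x] = (map_poly f q).[x].
  move=> xl; rewrite {2}(divp_eq q P) rmorphD rmorphM /= hornerD hornerM Pf xl.
  by rewrite subrr mulr0 add0r.
have mod_size (q : {poly F}) : (size (q %% P)%R <= l)%N by rewrite -ltnS -P_size ltn_modp.
have min_P (q : {poly F}) : root (map_poly f q) h -> P %| q.
  by move=> qh; apply/modp_eq0P/ker0; rewrite // rootE horner_mod.
case/(adjoinP P0 Ph) => q0 ->; rewrite -horner_mod // => {y} yl.
set q := q0 %% P in yl; have q_size : (size q <= l)%N := mod_size q0.
have [N [NM NC NX Np]] := poly_norm P_monic (etrans (congr1 (ltn 1) P_size) l_gt0).
have s0 : s != 0.
  have : (-1) ^+ l.+1 != 0 :> F by rewrite expf_neq0 // oppr_eq0 oner_eq0.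
  by rewrite sl expf_eq0 l_gt0.
have lj : (l %| j)%N.
  (* The norm of [h] is [(-1) ^+ l.+1 * z], that is [s ^+ l * z]; dividing by [s ^+ j] removes the
     sign. *)
  suff /indepF[] : (N q / s ^+ j) ^+ l = b ^+ (i * l) * z ^+ j by [].
  rewrite exprMn exprVn -exprM mulnC exprM -(poly_normX NM NC).
  have -> : N (q ^+ l) = N ((b ^+ i)%:P * 'X ^+ j).
    apply/Np/min_P; rewrite rootE rmorphB rmorphM !rmorphXn /= map_polyX map_polyC.
    by rewrite !hornerE /= yl subrr.
  rewrite NM NC (poly_normX NM NC) NX P_size /= -sl.
  rewrite coefB coefXn coefC eqxx eq_sym eqn0Ngt l_gt0 sub0r mulrN -mulNr -mulN1r.
  rewrite -exprS exprMn -exprM mulrCA -mulrA mulrC -!mulrA mulVf ?mulr1 //.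
  by rewrite !expf_neq0 // oppr_eq0 oner_eq0.
split=> //; set c := b ^+ i * z ^+ (j %/ l).
have c0 : c != 0 by rewrite mulf_neq0 // expf_neq0.
have qhl : (map_poly f q).[h] ^+ l = f c.
  by rewrite yl -{1}(divnK lj) mulnC exprM hl -!rmorphXn -rmorphM.
have qh0 : (map_poly f q).[h] != 0.
  by apply: contra_neq c0 => q0h; apply: (fmorph_inj f);
    rewrite -qhl q0h (rmorph0 f) expr0n eqn0Ngt l_gt0.
have fw_prim : l.-primitive_root (f w) by rewrite fmorph_primitive_root.
(* Conjugating [h] to [w h] turns [q(h)] into another [l]-th root of [c]. *)
have [k kE] : {k : 'I_l | (map_poly f q).[f w * h] / (map_poly f q).[h] = f w ^+ k}.
  apply: (prim_rootP fw_prim); rewrite exprMn exprVn qhl.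
  have /dvdpP[r] : P %| q ^+ l - c%:P.
    by apply: min_P; rewrite rootE rmorphB rmorphXn /= map_polyC !hornerE qhl subrr.
  move=> /(congr1 (fun r => (map_poly f r).[f w * h])).
  rewrite [map_poly f (r * P)]rmorphM rmorphB rmorphXn /= map_polyC hornerM Pf exprMn hl.
  rewrite (prim_expr_order fw_prim) mul1r subrr mulr0 !hornerE => /eqP.
  by rewrite subr_eq0 => /eqP ->; rewrite divff // fmorph_eq0.
(* Comparing [q] at [f w * h] with [f w ^+ k] times [q] at [h] gives a relation of degree less than
   [l] in [h], so each of its coefficients vanishes and [q] is a monomial. *)
have q_coef (m : 'I_l) : m != k -> q`_m = 0.
  move=> mk; pose r := \poly_(m < l) (q`_m * (w ^+ m - w ^+ k)).
  have /(congr1 (fun r : {poly F} => r`_m)) : r = 0.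
    apply: ker0; last exact: size_poly.
    rewrite rootE (@horner_coef_wide _ l) ?size_map_poly ?size_poly //.
    have -> : \sum_(i0 < l) (map_poly f r)`_i0 * h ^+ i0 =
        (map_poly f q).[f w * h] - f w ^+ k * (map_poly f q).[h].
      rewrite !(@horner_coef_wide _ l) ?size_map_poly ?size_poly //.
      rewrite big_distrr -sumrB /=; apply: eq_bigr => a _.
      rewrite !coef_map coef_poly ltn_ord /= rmorphM rmorphB !rmorphXn exprMn.
      by rewrite mulrBr mulrBl mulrA; congr (_ - _); rewrite mulrCA mulrA.
    by rewrite -kE divfK // subrr.
  rewrite coef0 coef_poly ltn_ord => /eqP; rewrite mulf_eq0 => /orP[/eqP //|].
  by rewrite subr_eq0 (eq_prim_root_expr w_prim) !modn_small // => /eqP/val_inj/eqP;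
    rewrite (negPf mk).
have qhE : (map_poly f q).[h] = f q`_k * h ^+ k.
  rewrite (@horner_coef_wide _ l) ?size_map_poly // (bigD1 k) //= big1 ?addr0.
    by rewrite coef_map.
  by move=> m mk; rewrite coef_map q_coef //= rmorph0 mul0r.
(* The extra factor [z ^+ (l.-1 * k)] completes [z ^+ k] to an [l]-th power and avoids a negative
   exponent; only the divisibility of [i] is kept. *)
suff /indepF[] : (q`_k * z ^+ k) ^+ l = b ^+ i * z ^+ (j %/ l + l.-1 * k) by [].
apply: (fmorph_inj f); rewrite exprD mulrA -/c [RHS]rmorphM -qhl qhE.
rewrite !(exprMn, rmorphM, rmorphXn) -mulrA; congr (_ * _).
rewrite [h ^+ k ^+ l]exprAC hl -!exprM -exprD; congr (_ ^+ _).
by rewrite -mulSn prednK // mulnC.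
Qed.

Lemma independent_tower (L : fieldType) (E : set L) (l : nat) (w s b : L)
    (z : nat -> L) (t m : nat) :
  prime l -> is_subfield E -> E w -> l.-primitive_root w ->
  E s -> (-1) ^+ l.+1 = s ^+ l -> E b -> b != 0 -> (forall k, z k != 0) ->
  (forall k, (k < m)%N -> z k.+1 ^+ l = z k) -> (t <= m)%N ->
  independent_mod l (adjoin E (z t)) b (z t) ->
  independent_mod l (adjoin E (z m)) b (z m).
Proof.
move=> l_prime E_subfield Ew w_prim Es sl Eb b0 z0 zl tm indep_t.
suff indep k : (t + k <= m)%N -> independent_mod l (adjoin E (z (t + k)%N)) b (z (t + k)%N).
  by rewrite -(subnKC tm); apply: indep; rewrite subnKC.
elim: k => [|k IHk]; rewrite ?addn0 // addnS => km.
set E' := adjoin E (z (t + k)%N) in IHk *.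
have E'_subfield : is_subfield E' := adjoin_subfield E _.
have EE' : E `<=` E' := @adjoin_base _ E _.
have [F [f fE]] := subfield_as_range E'_subfield.
have lift x : E' x -> exists y, f y = x by rewrite -fE => -[y _ <-]; exists y.
have [[w' w'E] [s' s'E]] := (lift w (EE' _ Ew), lift s (EE' _ Es)).
have [b' b'E] := lift b (EE' _ Eb).
have [z' z'E] := lift (z (t + k)%N) (@adjoin_gen _ E _).
(* Each level contains the previous one, since [z k] is the [l]-th power of [z k.+1]. *)
have -> : adjoin E (z (t + k).+1) = adjoin (range f) (z (t + k).+1).
  by rewrite fE adjoin_adjoin // -(zl _ km); apply: adjoinX.
rewrite -b'E; apply: (@independent_step _ _ f l w' s' b' z') => //.
- by rewrite -(fmorph_primitive_root f) w'E.
- by apply: (fmorph_inj f); rewrite !rmorphXn rmorphN1 s'E.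
- by rewrite -(fmorph_eq0 f) b'E.
- by rewrite -(fmorph_eq0 f) z'E.
- by rewrite zl.
- by rewrite fE b'E z'E; apply: IHk; apply: ltnW.
Qed.

(** * Kummer degree over a field with enough roots of unity *)

(** Extracting [l]-power roots in the equation for [alpha] costs only a power of [z]. So
    [alpha ^+ (l ^ (n - s))] is an element [c'] of [E], and the point is that for [s < n] the
    correction keeps [c'] from being an [l]-th power. *)
Lemma kummer_degree (L : fieldType) (E : set L) (l m n s : nat) (z c alpha : L) :
  prime l -> is_subfield E -> E z -> (l ^ m)%N.-primitive_root z -> (n <= m)%N ->
  E c -> c != 0 -> alpha ^+ (l ^ n) = c ^+ (l ^ s) ->
  ((s < n)%N -> forall x, E x -> x ^+ l <> c) ->
  has_degree E (adjoin E alpha) (l ^ (n - s)).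
Proof.
move=> l_prime E_subfield Ez z_prim nm Ec c0 alphaE c_nopow.
have l_gt0 := prime_gt0 l_prime.
have z0 : z != 0 by rewrite (prim_root_eq0 z_prim) -lt0n expn_gt0 l_gt0.
have [c' [Ec' c'E c'0 c'_nopow]] : exists c', [/\ E c', alpha ^+ (l ^ (n - s)) = c',
    c' != 0 & (0 < n - s)%N -> forall x, E x -> x ^+ l <> c'].
  have [sn|ns] := ltnP s n.
    have omega1 : (alpha ^+ (l ^ (n - s)) / c) ^+ (l ^ s) = 1.
      rewrite exprMn exprVn -exprM -expnD subnK ?(ltnW sn) // alphaE divff //.
      by rewrite expf_neq0.
    have [i iE] : {i : nat | alpha ^+ (l ^ (n - s)) / c = z ^+ i}.
      have [|i iE] := prim_rootP z_prim (x := alpha ^+ (l ^ (n - s)) / c).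
        have sm : (s <= m)%N by apply: leq_trans nm; apply: ltnW.
        by rewrite -(subnKC sm) expnD exprM omega1 expr1n.
      by exists i.
    have sm : (s < m)%N := leq_trans sn nm.
    (* The correction [z ^+ i] has order dividing [l ^ s] with [s < m], so it is itself an [l]-th
       power in [E]. *)
    have li : (l %| i)%N.
      move: omega1; rewrite iE -exprM => /eqP; rewrite -(prim_order_dvd z_prim).
      rewrite -(subnK (ltnW sm)) expnD dvdn_pmul2r ?expn_gt0 ?l_gt0 //.
      by apply: dvdn_trans; rewrite -{1}(expn1 l) dvdn_exp2l // subn_gt0.
    exists (c * z ^+ i); split.
    - by apply: subfieldM => //; apply: subfieldX.
    - by rewrite -iE mulrCA divff ?mulr1.
    - by rewrite mulf_neq0 // expf_neq0.
    move=> _ x Ex xl; apply: (c_nopow sn (x / z ^+ (i %/ l))).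
      by apply: subfieldM => //; apply: subfieldV => //; apply: subfieldX.
    by rewrite exprMn exprVn -exprM divnK // xl mulfK // expf_neq0.
  (* For [n <= s], [alpha] itself lies in [E], and the degree is [l ^ 0 = 1]. *)
  have c1 : c ^+ (l ^ (s - n)) != 0 by rewrite expf_neq0.
  have [|i iE] := prim_rootP z_prim (x := alpha / c ^+ (l ^ (s - n))).
    rewrite -(subnKC nm) expnD exprM exprMn exprVn -exprM -expnD subnK // alphaE.
    by rewrite divff ?expr1n // expf_neq0.
  have ns0 : (n - s = 0)%N by apply/eqP; rewrite subn_eq0.
  exists (c ^+ (l ^ (s - n)) * z ^+ i); rewrite ns0; split=> //.
  - by apply: subfieldM => //; apply: subfieldX.
  - by rewrite -iE mulrCA divff ?mulr1.
  - by rewrite mulf_neq0 // expf_neq0.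
have [F [f fE]] := subfield_as_range E_subfield.
rewrite -fE in Ec' Ez c'_nopow *.
case: Ec' c'E c'0 c'_nopow => c1 _ <- c'E c'0 c'_nopow.
case: Ez z_prim => z1 _ <-; rewrite fmorph_primitive_root => z1_prim.
have e_dvd : (l ^ (n - s) %| l ^ m)%N.
  by rewrite dvdn_exp2l // (leq_trans (leq_subr _ _) nm).
apply: (has_degree_adjoin _ c'E); first by rewrite expn_gt0 l_gt0.
apply: (kummer_root_size l_prime (dvdn_prim_root z1_prim e_dvd) _ c'E).
  by rewrite -(fmorph_eq0 f).
move=> e_gt0 x xl; apply: (c'_nopow e_gt0 (f x)); first by exists x.
by rewrite -rmorphXn xl.
Qed.

(** * Cyclotomic fields and the theorem *)

Lemma prim_root_pow (F : fieldType) (n : nat) (w x : F) :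
  n.-primitive_root w -> n.-primitive_root x -> exists i, x = w ^+ i.
Proof.
move=> w_prim x_prim; have [i ->] := prim_rootP w_prim (prim_expr_order x_prim).
by exists i.
Qed.

(** The chosen roots [zeta k] need not be compatible with one another; this allows them to be
    replaced by powers of the single root [zeta m]. *)
Lemma eq_cyclo (K : fieldType) (L : closedFieldType) (iota : {rmorphism K -> L})
    (zeta : nat -> L) (n k : nat) (x : L) :
  n.-primitive_root (zeta k) -> n.-primitive_root x ->
  cyclo iota zeta k = adjoin (range iota) x.
Proof.
move=> zeta_prim x_prim.
have [i xE] := prim_root_pow zeta_prim x_prim.
have [j zetaE] := prim_root_pow x_prim zeta_prim.
apply: eq_adjoin; [rewrite zetaE | rewrite xE];
exact: adjoinX.
Qed.

(** For odd [l] the sign is [1]; for [l = 2] it is [-1], the square of a primitive fourth root of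
    unity. *)
Lemma signed_lroot (K L : fieldType) (iota : {rmorphism K -> L}) (l : nat) (z : L) :
  (l ^ 2)%N.-primitive_root z -> odd l \/ (l = 2%N /\ range iota z) ->
  exists s : K, (-1) ^+ l.+1 = s ^+ l.
Proof.
move=> z_prim [l_odd|[l2 [s _ sE]]].
  by exists 1; rewrite -signr_odd /= l_odd expr0 expr1n.
move: z_prim; rewrite -sE fmorph_primitive_root l2 => s_prim; exists s.
have /eqP : (s ^+ 2 - 1) * (s ^+ 2 + 1) = 0.
  by rewrite -subr_sqr -exprM expr1n (prim_expr_order s_prim) subrr.
rewrite mulf_eq0 subr_eq0 -(prim_order_dvd s_prim) /= addr_eq0 => /eqP ->.
by rewrite exprS sqrrN !expr1n mulr1.
Qed.

Lemma prim_root_expl (R : nzRingType) (l m k : nat) (z : R) :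
  prime l -> (k <= m)%N -> (l ^ m)%N.-primitive_root z ->
  (l ^ k)%N.-primitive_root (z ^+ (l ^ (m - k))).
Proof.
move=> l_prime km z_prim; rewrite expnB ?prime_gt0 //.
by apply: dvdn_prim_root => //; apply: dvdn_exp2l.
Qed.

(** The tower consists of the [z ^+ (l ^ (m - k))], each the [l]-th power of the next. It starts at
    [t], the last level inside [F], where [independent_base] applies. *)
Lemma independent_cyclo (F L : fieldType) (f : {rmorphism F -> L}) (l t m : nat)
    (s b : F) (z : L) :
  prime l -> (-1) ^+ l.+1 = s ^+ l -> b != 0 -> strongly_indivisible l b ->
  (0 < t <= m)%N -> (l ^ m)%N.-primitive_root z -> range f (z ^+ (l ^ (m - t))) ->
  (forall w : F, ~ (l ^ t.+1)%N.-primitive_root w) ->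
  independent_mod l (adjoin (range f) z) (f b) z.
Proof.
move=> l_prime sl b0 b_sind /andP[t_gt0 tm] z_prim zt_range no_prim.
have f_subfield := range_subfield f.
have z0 : z != 0 by rewrite (prim_root_eq0 z_prim) -lt0n expn_gt0 prime_gt0.
have zmm : z = z ^+ (l ^ (m - m)) by rewrite subnn expr1.
have zt_prim := prim_root_expl l_prime tm z_prim.
rewrite zmm; pose zs k := z ^+ (l ^ (m - k)); rewrite -/(zs m).
apply: (@independent_tower _ _ l (zs 1%N) (f s) _ zs t) => //.
- have -> : zs 1%N = zs t ^+ (l ^ t.-1).
    by rewrite /zs -exprM -expnD; congr (_ ^+ (_ ^ _)); lia.
  exact: subfieldX.
- by rewrite -[X in X.-primitive_root _]expn1 prim_root_expl // (leq_trans t_gt0).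
- by rewrite -rmorphXn -sl rmorphXn rmorphN1.
- by rewrite fmorph_eq0.
- by move=> k; rewrite expf_neq0.
- by move=> k km; rewrite /zs -exprM -expnSr subnSK.
rewrite adjoin_id //; case: zt_range (zt_prim) => z' _ z'E; rewrite /zs -z'E.
rewrite fmorph_primitive_root => z'_prim.
exact: independent_base t_gt0 z'_prim no_prim b0 b_sind.
Qed.

(** The base of the tower is the field generated by the [l]-th roots of unity, to which strong
    indivisibility of [b] passes. *)
Lemma not_lpower_cyclo (K L : fieldType) (iota : {rmorphism K -> L}) (l m : nat)
    (s b : K) (z : L) :
  prime l -> (-1) ^+ l.+1 = s ^+ l -> b != 0 -> strongly_indivisible l b ->
  (0 < m)%N -> (l ^ m)%N.-primitive_root z ->
  forall x, adjoin (range iota) z x -> x ^+ l <> iota b.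
Proof.
move=> l_prime sl b0 b_sind m_gt0 z_prim x Ex xl.
pose z1 := z ^+ (l ^ (m - 1)); pose E1 := adjoin (range iota) z1.
have z1_prim : l.-primitive_root z1.
  by rewrite -[X in X.-primitive_root _]expn1 prim_root_expl.
have [F [f fE]] := subfield_as_range (adjoin_subfield (range iota) z1).
have lift y : range iota y -> exists y', f y' = y.
  move=> iy; have : adjoin (range iota) z1 y by apply: adjoin_base.
  by rewrite -fE => -[y' _ <-]; exists y'.
have [b1 b1E] := lift (iota b) (ex_intro2 _ _ b I erefl).
have [s1 s1E] := lift (iota s) (ex_intro2 _ _ s I erefl).
have b1_sind := strongly_indivisible_adjoin l_prime z1_prim fE b1E b0 b_sind.
have b1_neq0 : b1 != 0 by rewrite -(fmorph_eq0 f) b1E fmorph_eq0.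
have s1l : (-1) ^+ l.+1 = s1 ^+ l.
  by apply: (fmorph_inj f); rewrite !rmorphXn s1E -(rmorphXn iota) -sl rmorphXn !rmorphN1.
move: Ex; rewrite -(@adjoin_adjoin _ _ z1) -?fE; last exact: adjoinX.
(* If [z] already lies in the base there is no tower to climb, and strong indivisibility with the
   root of unity [1] concludes. *)
move=> Ex; have [fz|nfz] := pselect (range f z).
  move: Ex; rewrite adjoin_id //; last exact: range_subfield.
  case=> y _ yE; apply: (b1_sind 1); first by exists 1%N; rewrite ?expr1n.
  by exists y; apply: (fmorph_inj f); rewrite mulr1 rmorphXn yE b1E.
(* The level [t] comes just before the least level outside the base; that level is at least [2],
   because levels [0] and [1] lie inside. *)
have [t [t_gt0 tm zt zt1]] : exists t, [/\ (0 < t)%N, (t < m)%N,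
    range f (z ^+ (l ^ (m - t))) & ~ range f (z ^+ (l ^ (m - t.+1)))].
  pose outside k := ~~ `[< range f (z ^+ (l ^ (m - k))) >].
  have out_m : exists k, outside k.
    by exists m; apply/asboolPn; rewrite subnn expr1.
  case: (ex_minnP out_m) => k k_out k_min.
  have k_gt1 : (1 < k)%N.
    case: k k_out {k_min} => [|[|//]] /asboolPn[].
      by rewrite subn0 (prim_expr_order z_prim); exists 1; rewrite ?rmorph1.
    by rewrite fE; apply: adjoin_gen.
  have km : (k <= m)%N by apply: k_min; apply/asboolPn; rewrite subnn expr1.
  exists k.-1; rewrite prednK ?(ltnW k_gt1) //; split=> //.
  - by rewrite -ltnS prednK // ltnW.
  - apply: contrapT => k1; have := k_min k.-1 (introT (asboolPn _) k1).
    by rewrite leqNgt prednK ?leqnn // ltnW.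
  - exact/asboolPn.
have no_prim (w : F) : ~ (l ^ t.+1)%N.-primitive_root w.
  rewrite -(fmorph_primitive_root f) => w_prim; apply: zt1.
  have [i ->] := prim_root_pow w_prim (prim_root_expl l_prime tm z_prim).
  by exists (w ^+ i); rewrite ?rmorphXn.
have tm' : (0 < t <= m)%N by rewrite t_gt0 ltnW.
have := independent_cyclo l_prime s1l b1_neq0 b1_sind tm' z_prim zt no_prim.
move=> /(_ 1%N 0%N x Ex); rewrite expr1 mulr1 b1E => /(_ xl)[].
by rewrite dvdn1 => /eqP l1; rewrite l1 in l_prime.
Qed.

(* Subtraction on nat is truncated: n - d stands for max(0, n - d),
   t - d for max(0, t - d) and n + r - m for max(0, n + r - m). *)
Theorem theorem11
  (K : fieldType) (Kbar : closedFieldType) (iota : {rmorphism K -> Kbar})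
  (Kbar_closure : is_algebraic_closure iota)
  (l : nat) (l_prime : prime l) (l_pchar : l \notin [pchar K])
  (zeta : nat -> Kbar)
  (zeta_prim : forall k : nat, (1 <= k)%N -> (l ^ k)%N.-primitive_root (zeta k))
  (l_cond : odd l \/ (l = 2%N /\ range iota (zeta 2%N)))
  (a : K) (a_neq0 : a != 0)
  (m n : nat) (n_gt0 : (0 < n)%N) (n_le_m : (n <= m)%N)
  (alpha : Kbar) (alpha_root : alpha ^+ (l ^ n) = iota a) :
  (forall (b : K) (d : nat),
     b != 0 -> strongly_indivisible l b -> a = b ^+ (l ^ d) ->
     has_degree (cyclo iota zeta m) (adjoin (cyclo iota zeta m) alpha)
       (l ^ (n - d)))
  /\
  (range iota = cyclo iota zeta 1 ->
   range iota <> cyclo_infty iota zeta ->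
   forall t : nat,
     (1 <= t)%N ->
     cyclo iota zeta t = range iota ->
     (forall k : nat, (1 <= k)%N -> cyclo iota zeta k = range iota ->
        (k <= t)%N) ->
     (t <= m)%N ->
     forall (b : K) (d : nat) (xi : K) (r : nat),
       b != 0 -> strongly_indivisible l b -> (0 < d)%N ->
       (l ^ r)%N.-primitive_root xi -> (t - d < r)%N ->
       a = b ^+ (l ^ d) * xi ->
       has_degree (cyclo iota zeta m) (adjoin (cyclo iota zeta m) alpha)
         (l ^ maxn (n - d) (n + r - m))).
Proof.
have m_gt0 : (0 < m)%N := leq_trans n_gt0 n_le_m.
have zm_prim := zeta_prim m m_gt0; set z := zeta m in zm_prim *.
have [s sl] := signed_lroot (zeta_prim 2%N isT) l_cond.
have cyclo_subfield : is_subfield (cyclo iota zeta m) := adjoin_subfield _ _.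
have cyclo_z : cyclo iota zeta m z := @adjoin_gen _ _ _.
have cyclo_iota x : cyclo iota zeta m (iota x).
  by apply: (@adjoin_base _ (range iota)); exists x.
split=> [b d b0 b_sind aE|_ _ t t_gt0 zeta_t t_max tm b d xi r b0 b_sind d_gt0].
  apply: (kummer_degree l_prime cyclo_subfield cyclo_z zm_prim n_le_m (cyclo_iota b)).
  - by rewrite fmorph_eq0.
  - by rewrite alpha_root aE rmorphXn.
  - by move=> _; apply: not_lpower_cyclo sl b0 b_sind m_gt0 zm_prim.
move=> xi_prim rtd aE.
have prim_le k (w : K) : (l ^ k.+1)%N.-primitive_root w -> (k < t)%N.
  rewrite -(fmorph_primitive_root iota) => w_prim; apply: t_max => //.
  rewrite (eq_cyclo iota (zeta_prim k.+1 isT) w_prim) adjoin_id //.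
  exact: range_subfield.
have zt_range : range iota (z ^+ (l ^ (m - t))).
  have zt_prim := prim_root_expl l_prime tm zm_prim.
  by rewrite -zeta_t (eq_cyclo iota (zeta_prim t t_gt0) zt_prim); apply: adjoin_gen.
have no_prim (w : K) : ~ (l ^ t.+1)%N.-primitive_root w.
  by move/prim_le; rewrite ltnn.
have tm' : (0 < t <= m)%N by rewrite t_gt0.
have indep := independent_cyclo l_prime sl b0 b_sind tm' zm_prim zt_range no_prim.
have r_gt0 : (0 < r)%N := leq_ltn_trans (leq0n _) rtd.
have rm : (r <= m)%N.
  by apply: leq_trans tm; case: r r_gt0 xi_prim {rtd} => // k _; apply: prim_le.
have zr_prim := prim_root_expl l_prime rm zm_prim.
have [u xiE] : exists u, iota xi = z ^+ (l ^ (m - r)) ^+ u.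
  by apply: prim_root_pow zr_prim _; rewrite fmorph_primitive_root.
(* Both [xi] and [z ^+ (l ^ (m - r))] have order [l ^ r] with [r > 0]. *)
have u_coprime : ~~ (l %| u)%N.
  move: xi_prim; rewrite -(fmorph_primitive_root iota) xiE.
  by rewrite prim_root_exp_coprime // coprime_pexpr // coprime_sym prime_coprime.
(* Over [K_(l^m)], [a] is [b ^+ (l ^ d)] times [z ^+ (l ^ (m - r) * u)]. Here [l ^ e] is the largest
   power of [l] dividing both exponents, and [c] is the resulting root. *)
pose e := minn d (m - r).
pose c := iota b ^+ (l ^ (d - e)) * z ^+ (l ^ (m - r - e) * u).
have -> : maxn (n - d) (n + r - m) = (n - e)%N by rewrite /e; lia.
have z0 : z != 0 by rewrite (prim_root_eq0 zm_prim) -lt0n expn_gt0 prime_gt0.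
apply: (kummer_degree l_prime cyclo_subfield cyclo_z zm_prim n_le_m (c := c)).
- by apply: (subfieldM cyclo_subfield); apply: (subfieldX cyclo_subfield).
- by rewrite mulf_neq0 // expf_neq0 // fmorph_eq0.
- rewrite alpha_root aE rmorphM rmorphXn xiE exprMn -!exprM.
  by rewrite mulnAC -!expnD !subnK ?geq_minl ?geq_minr.
(* Were [c] an [l]-th power, independence would make both [d - e] and [m - r - e] positive, against
   the choice of [e]. *)
move=> _ x Ex /(indep _ _ _ Ex)[]; rewrite Euclid_dvdM // (negPf u_coprime) orbF.
rewrite !Euclid_dvdX // dvdnn /= !subn_gt0 => de mre.
by move: de mre; rewrite /e; lia.
Qed.
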